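(* Let $\hat\xi\in\mathbb R^p$ and $\hat\Upsilon\succeq0$ ($p\times p$) be estimators of unknown parameters $\xi\in\mathbb R^p$ and $\Upsilon\in\mathbb R^{p\times p}$, put $\varpi=\Upsilon^{-1}\xi$, $\vartheta=\xi^T\Upsilon^{-1}\xi$, and let $$\hat\varpi\in\operatorname*{argmin}_{\|\beta\|_2\le\gamma}\ \tfrac12\beta^T\hat\Upsilon\beta-\beta^T\hat\xi+\lambda\|\beta\|_1,\qquad \hat\vartheta=2\hat\xi^T\hat\varpi-\hat\varpi^T\hat\Upsilon\hat\varpi,$$ with $\gamma\asymp\sqrt\tau$. If there exist some constants $c_1,c_2>0$ such that $$\mathbb P(\|\hat\xi-\xi\|_\infty>t)\le c_1p\,e^{-c_2mt^2}\qquad\forall t>0,$$ then $$\sup_{(\xi,\Upsilon)\in\mathcal H(s,\tau)}\mathbb E\|\hat\varpi-\varpi\|_2^2\lesssim\lambda^2s+\tau\big[\mathbb P(\mathcal A^c(\lambda))+\mathbb P(\mathcal B^c(s,\sqrt{c_L}/2))\big],$$ $$\sup_{(\xi,\Upsilon)\in\mathcal H(s,\tau)}\mathbb E|\hat\vartheta-\vartheta|\lesssim\lambda s\big(\lambda+\sqrt{\log p/m}\big)+(\sqrt\tau+\tau)\,p\,\sqrt{\mathbb P(\mathcal A^c(\lambda))+\mathbb P(\mathcal B^c(s,\sqrt{c_L}/2))}$$ $$\qquad\qquad+\sup_{(\xi,\Upsilon)\in\mathcal H(s,\tau)}\mathbb E|\varpi^T(\hat\Upsilon-\Upsilon)\varpi|+\sup_{(\xi,\Upsilon)\in\mathcal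 H(s,\tau)}\sqrt{\mathbb E|\varpi^T(\hat\xi-\xi)|^2}.$$
   Context: No sub-gaussian assumption on the data is made here. The quantity $m$ is the parameter appearing in the concentration condition on $\hat\xi$, playing the role of a sample size; $\lambda>0$ is the regularization parameter. The probabilities $\mathbb P(\mathcal A^c(\lambda))$ and $\mathbb P(\mathcal B^c(s,\sqrt{c_L}/2))$ depend on $(\xi,\Upsilon)$ and, on the right-hand sides, are to be read as suprema over $(\xi,\Upsilon)\in\mathcal H(s,\tau)$. Parameter space: with fixed constants $0<c_L<c_U$, an integer $1\le s\le p$ and $\tau>0$, $$\mathcal H(s,\tau)=\{(\xi,\Upsilon):\|\Upsilon^{-1}\xi\|_0\le s,\ \xi^T\Upsilon^{-1}\xi\le\tau,\ c_L\le\lambda_{\min}(\Upsilon)\le\delta_\Upsilon\le c_U\},$$ where $\Upsilon$ is symmetric positive definite, $\|\cdot\|_0$ counts nonzero entries, $\delta_\Upsilon=\max_i\Upsilon_{ii}$. Cone and events: with $[p]=\{1,\dots,p\}$, $u_S$ the subvector of $u$ indexed by $S$, and $B_2(1)$ the Euclidean unit ball of $\mathbb R^p$, $$\mathcal K(s)=\{u\in\mathbb R^p:\ \|u_{S^c}\|_1\le3\|u_S\|_1\text{ for some }S\subseteq[p],\ |S|\le s\},$$ $$\mathcal A(\lambda)=\{\|\hat\Upsilon\varpi-\hat\xi\|_\infty\le\lambda/2\},\qquad \mathcal B(s,\kappa)=\Big\{\max_{u\in\mathcal K(s)\cap B_2(1)}\big|\sqrt{u^T\Upsilon u}-\sqrt{u^T\hat\Upsilon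 u}\big|\le\kappa\Big\},$$ and the superscript $c$ on an event denotes its complement. $f\lesssim g$ means $f\le Cg$ for some constant $C>0$; $f\asymp g$ means both $f\lesssim g$ and $g\lesssim f$.
   Formalization: γ≍√τ is taken as k1√τ ≤ γ ≤ k2√τ with k1 ≥ 1/√c_L, so that ϖ is feasible over all of H(s,τ) (for smaller γ the first bound is false), and m ≥ 1 is assumed, as for a sample size (the second bound fails uniformly as m→0). *)

(* Defs.v *)
(* MathComp-Analysis, over an arbitrary [R : realType].  Vectors of R^p are
   column vectors ['cV[R]_p]. *)
From HB Require Import structures.
From mathcomp Require Export all_boot all_order all_algebra.
From mathcomp Require Export all_classical all_reals all_analysis.

Set Implicit Arguments.
Unset Strict Implicit.
Unset Printing Implicit Defensive.

Export Order.TTheory GRing.Theory Num.Theory.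
Export numFieldNormedType.Exports.

#[export] Set Implicit Arguments.
#[export] Unset Strict Implicit.
#[export] Unset Printing Implicit Defensive.

Global Open Scope classical_set_scope.
Global Open Scope ring_scope.

Section LinearAlgebra.
Variables (R : realType) (p : nat).
Implicit Types (u v beta xi : 'cV[R]_p) (A Upsilon : 'M[R]_p).

Definition dotv u v : R := (u^T *m v) 0 0.

Definition quadf A u : R := dotv u (A *m u).

Definition norm2 u : R := Num.sqrt (\sum_i u i 0 ^+ 2).
Definition norm1 u : R := \sum_i `|u i 0|.
Definition norm0 u : nat := #|[pred i | u i 0 != 0]|.
(* The norm of ['cV[R]_p] provided by the library is the maximum of the
   absolute values of the entries. *)
Definition norminf u : R := `|u|.

Definition is_psd A : Prop := A^T = A /\ forall u, 0 <= quadf A u.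
Definition is_posdef A : Prop := A^T = A /\ forall u, u != 0 -> 0 < quadf A u.

(* Meant for symmetric [A] and [0 < p]: the set of (real) eigenvalues is then
   finite and nonempty, and the infimum is a minimum. *)
Definition lambda_min A : R := inf [set a : R | eigenvalue A a].

(* Meant for matrices with nonnegative diagonal (e.g. positive definite ones),
   so that the initial value [0] of the maximum is harmless. *)
Definition max_diag A : R := \big[Num.max/0]_(i < p) A i i.

Definition varpi_of (theta : 'cV[R]_p * 'M[R]_p) : 'cV[R]_p :=
  invmx theta.2 *m theta.1.
Definition vartheta_of (theta : 'cV[R]_p * 'M[R]_p) : R :=
  dotv theta.1 (invmx theta.2 *m theta.1).

(* A parameter is a pair [theta = (xi, Upsilon)]. *)
Definition param_space (cL cU : R) (s : nat) (tau : R) :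
    set ('cV[R]_p * 'M[R]_p) :=
  [set theta | let xi := theta.1 in let Upsilon := theta.2 in
    [/\ is_posdef Upsilon,
        (norm0 (invmx Upsilon *m xi) <= s)%N,
        dotv xi (invmx Upsilon *m xi) <= tau,
        cL <= lambda_min Upsilon <= max_diag Upsilon &
        max_diag Upsilon <= cU] ].

Definition cone (s : nat) : set 'cV[R]_p :=
  [set u | exists S : {set 'I_p}, (#|S| <= s)%N /\
    \sum_(i | i \notin S) `|u i 0| <= 3 * \sum_(i in S) `|u i 0| ].

Definition ball2 (r : R) : set 'cV[R]_p := [set u | norm2 u <= r].

Definition objective (Uhat : 'M[R]_p) (xihat : 'cV[R]_p) (lambda : R) beta : R :=
  2^-1 * quadf Uhat beta - dotv beta xihat + lambda * norm1 beta.

End LinearAlgebra.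

Definition argmin (R : realType) (V : Type) (D : set V) (f : V -> R) : set V :=
  [set x | D x /\ forall y, D y -> f x <= f y].

Section Estimators.
Variables (R : realType) (p : nat) (d : measure_display) (T : measurableType d).
Implicit Types (theta : 'cV[R]_p * 'M[R]_p).

Definition measurable_vec (X : T -> 'cV[R]_p) : Prop :=
  forall i, measurable_fun [set: T] (fun w => X w i 0).
Definition measurable_mat (X : T -> 'M[R]_p) : Prop :=
  forall i j, measurable_fun [set: T] (fun w => X w i j).

Definition vartheta_hat (xihat : T -> 'cV[R]_p) (Uhat : T -> 'M[R]_p)
    (varpihat : T -> 'cV[R]_p) (w : T) : R :=
  2 * dotv (xihat w) (varpihat w) - quadf (Uhat w) (varpihat w).

Definition event_A (xihat : T -> 'cV[R]_p) (Uhat : T -> 'M[R]_p) (lambda : R)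
    theta : set T :=
  [set w | norminf (Uhat w *m varpi_of theta - xihat w) <= lambda / 2].

Definition event_B (Uhat : T -> 'M[R]_p) (s : nat) (kappa : R) theta : set T :=
  [set w | (ereal_sup
     [set `|Num.sqrt (quadf theta.2 u) - Num.sqrt (quadf (Uhat w) u)|%:E
       | u in cone s `&` @ball2 R p 1%R] <= kappa%:E)%E].

End Estimators.

(* Main.v *)
(* On the event [A `&` B] the optimality of [varpihat] against [varpi] puts the
   error [Delta = varpihat - varpi] in the cone [K(s)], where the event [B]
   transfers the lower bound [cL] on the eigenvalues of [Upsilon] to [Uhat];
   this gives [cL / 4 * |Delta|_2^2 <= Delta^T Uhat Delta <= 3 lambda sqrt(s) |Delta|_2].
   Off [A `&` B] the constraint [|varpihat|_2 <= gamma] bounds the error.  For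
   the functional, [vartheta_hat - vartheta = 2 varpi^T (xihat - xi)
   - varpi^T (Uhat - Upsilon) varpi + 2 (xihat - Uhat varpi)^T Delta
   - Delta^T Uhat Delta] on [A `&` B], while comparing [varpihat] with [0] gives
   [0 <= vartheta_hat <= 2 xihat^T varpihat], whose expectation off [A `&` B] is
   controlled by Cauchy-Schwarz and the tail condition on [xihat]. *)
From HB Require Import structures.
Require Import Defs.
From mathcomp Require Import ring lra measurable_realfun.

(** * Inner products, norms and positive semidefinite forms *)

Section LinAlg.
Variables (R : realType) (p : nat).
Implicit Types (u v w : 'cV[R]_p) (A B : 'M[R]_p) (a b : R).

Lemma dotvE u v : dotv u v = \sum_i u i 0 * v i 0.
Proof. by rewrite /dotv mxE; apply: eq_bigr => i _; rewrite mxE. Qed.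

Lemma dotvC u v : dotv u v = dotv v u.
Proof. by rewrite !dotvE; apply: eq_bigr => i _; rewrite mulrC. Qed.

Lemma dotvDl u v w : dotv (u + v) w = dotv u w + dotv v w.
Proof. by rewrite /dotv linearD/= mulmxDl mxE. Qed.

Lemma dotvDr u v w : dotv u (v + w) = dotv u v + dotv u w.
Proof. by rewrite dotvC dotvDl !(dotvC u). Qed.

Lemma dotvZl a u v : dotv (a *: u) v = a * dotv u v.
Proof. by rewrite /dotv linearZ/= -scalemxAl mxE. Qed.

Lemma dotvZr a u v : dotv u (a *: v) = a * dotv u v.
Proof. by rewrite dotvC dotvZl dotvC. Qed.

Lemma dotvNl u v : dotv (- u) v = - dotv u v.
Proof. by rewrite -scaleN1r dotvZl mulN1r. Qed.

Lemma dotvNr u v : dotv u (- v) = - dotv u v.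
Proof. by rewrite dotvC dotvNl dotvC. Qed.

Definition dotv_lin := (dotvDl, dotvDr, dotvNl, dotvNr, dotvZl, dotvZr).

Lemma dotv0l v : dotv 0 v = 0.
Proof. by rewrite -(scale0r 0) dotvZl mul0r. Qed.

Lemma dotv_mulmx A u v : dotv u (A *m v) = dotv (A^T *m u) v.
Proof. by rewrite /dotv trmx_mul trmxK mulmxA. Qed.

Lemma dotv_sym A u v : A^T = A -> dotv u (A *m v) = dotv v (A *m u).
Proof. by move=> sA; rewrite dotv_mulmx sA dotvC. Qed.

Lemma quadfZ A a u : quadf A (a *: u) = a ^+ 2 * quadf A u.
Proof. by rewrite /quadf -scalemxAr !dotv_lin mulrA expr2. Qed.

Lemma quadf0 A : quadf A 0 = 0.
Proof. exact: dotv0l. Qed.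

Lemma quadfB A B u : quadf (A - B) u = quadf A u - quadf B u.
Proof. by rewrite /quadf mulmxBl !dotv_lin. Qed.

Lemma quadf_scalar a u : quadf a%:M u = a * dotv u u.
Proof. by rewrite /quadf mul_scalar_mx dotvZr. Qed.

Lemma dotvv_ge0 u : 0 <= dotv u u.
Proof. by rewrite dotvE sumr_ge0// => i _; rewrite -expr2 sqr_ge0. Qed.

Lemma dotvv_eq0 u : (dotv u u == 0) = (u == 0).
Proof.
apply/eqP/eqP => [|->]; last exact: dotv0l.
rewrite dotvE => /eqP.
rewrite psumr_eq0 => [/allP u0|i _]; last by rewrite -expr2 sqr_ge0.
apply/matrixP => i j; rewrite (ord1 j) mxE.
by have := u0 i (mem_index_enum _); rewrite -expr2 sqrf_eq0 => /eqP.
Qed.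

Lemma norm2_ge0 u : 0 <= norm2 u.
Proof. exact: sqrtr_ge0. Qed.

Lemma sqr_norm2 u : norm2 u ^+ 2 = dotv u u.
Proof.
rewrite /norm2 sqr_sqrtr; last by apply: sumr_ge0 => i _; exact: sqr_ge0.
by rewrite dotvE.
Qed.

Lemma norm2_eq0 u : (norm2 u == 0) = (u == 0).
Proof. by rewrite -dotvv_eq0 -sqr_norm2 sqrf_eq0. Qed.

Lemma norm2Z a u : norm2 (a *: u) = `|a| * norm2 u.
Proof.
apply/eqP; rewrite -(@eqrXn2 _ 2)// ?mulr_ge0 ?norm2_ge0//.
by rewrite exprMn !sqr_norm2 !dotv_lin real_normK ?num_real// mulrA expr2.
Qed.

Lemma norm1_ge0 u : 0 <= norm1 u.
Proof. exact: sumr_ge0. Qed.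

(** The polynomial t -> [quadf A (u + t *: v)] is nonnegative everywhere, which forces its
    discriminant to be nonpositive; a vanishing leading coefficient [quadf A v] is treated apart. *)
Lemma psd_cauchy_schwarz A u v : is_psd A ->
  dotv u (A *m v) ^+ 2 <= quadf A u * quadf A v.
Proof.
move=> [sA psdA]; set b := dotv _ _.
have q t : 0 <= quadf A v * t ^+ 2 + 2 * b * t + quadf A u.
  have := psdA (u + t *: v).
  rewrite /quadf mulmxDr -scalemxAr !dotv_lin (dotv_sym v u sA) -/b.
  by congr (_ <= _); ring.
have := psdA v; rewrite le_eqVlt => /predU1P[v0|v0]; first rewrite -v0 in q *.
  have [->|b0] := eqVneq b 0; first by rewrite expr0n mulr0.
  (* The polynomial is now affine with nonzero slope; this point is chosen to give it the value
     -1. *)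
  have := q (- (quadf A u + 1) / (2 * b)).
  have -> : 0 * (- (quadf A u + 1) / (2 * b)) ^+ 2 +
     2 * b * (- (quadf A u + 1) / (2 * b)) + quadf A u = -1 by field.
  by rewrite lerNr oppr0 ler10.
(* The minimizer of the quadratic polynomial. *)
have := q (- b / quadf A v).
have -> : quadf A v * (- b / quadf A v) ^+ 2 +
     2 * b * (- b / quadf A v) + quadf A u =
  (quadf A u * quadf A v - b ^+ 2) / quadf A v by field; rewrite gt_eqF.
by rewrite pmulr_lge0 ?invr_gt0// subr_ge0.
Qed.

Lemma is_psd_scalar a : 0 <= a -> is_psd (a%:M : 'M[R]_p).
Proof.
move=> a0; split=> [|u]; first by rewrite tr_scalar_mx.
by rewrite quadf_scalar mulr_ge0// dotvv_ge0.
Qed.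

Lemma dotv_le_norm2 u v : `|dotv u v| <= norm2 u * norm2 v.
Proof.
rewrite -ler_sqr ?nnegrE ?mulr_ge0 ?norm2_ge0//.
rewrite real_normK ?num_real// exprMn !sqr_norm2.
have := psd_cauchy_schwarz u v (is_psd_scalar ler01).
by rewrite !quadf_scalar mul1mx !mul1r.
Qed.

Lemma norm2D u v : norm2 (u + v) <= norm2 u + norm2 v.
Proof.
rewrite -ler_sqr ?nnegrE ?addr_ge0 ?norm2_ge0//.
rewrite sqrrD !sqr_norm2 !dotv_lin (dotvC v u).
have := le_trans (ler_norm _) (dotv_le_norm2 u v); lra.
Qed.

Lemma norm2N u : norm2 (- u) = norm2 u.
Proof. by rewrite -scaleN1r norm2Z normrN1 mul1r. Qed.

Lemma norm2B u v : norm2 (u - v) <= norm2 u + norm2 v.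
Proof. by rewrite -(norm2N v) norm2D. Qed.

Lemma ler_norminf u i : `|u i 0| <= norminf u.
Proof.
rewrite /norminf /Num.norm/= mx_normrE.
by apply: (le_bigmax _ (fun ij => `|u ij.1 ij.2|) (i, 0)).
Qed.

Lemma norminf_ge0 u : 0 <= norminf u.
Proof. exact: normr_ge0. Qed.

Lemma dotv_le_norminf u v : `|dotv u v| <= norminf u * norm1 v.
Proof.
rewrite dotvE /norm1 mulr_sumr (le_trans (ler_norm_sum _ _ _))//.
by apply: ler_sum => i _; rewrite normrM ler_wpM2r// ler_norminf.
Qed.

(** Cauchy-Schwarz between the indicator vector of [S] and the vector of absolute values. *)
Lemma sum_abs_le_norm2 (S : {set 'I_p}) u :
  \sum_(i in S) `|u i 0| <= Num.sqrt #|S|%:R * norm2 u.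
Proof.
set x : 'cV[R]_p := \col_i (i \in S)%:R.
set y : 'cV[R]_p := \col_i `|u i 0|.
have -> : \sum_(i in S) `|u i 0| = dotv x y.
  rewrite dotvE big_mkcond/=; apply: eq_bigr => i _; rewrite !mxE.
  by case: ifP; rewrite ?mul1r ?mul0r.
have -> : Num.sqrt #|S|%:R = norm2 x.
  congr Num.sqrt; rewrite -sum1_card natr_sum big_mkcond/=.
  by apply: eq_bigr => i _; rewrite mxE; case: ifP; rewrite ?expr1n ?expr0n.
have -> : norm2 u = norm2 y.
  congr Num.sqrt; apply: eq_bigr => i _.
  by rewrite mxE real_normK ?num_real.
exact: le_trans (ler_norm _) (dotv_le_norm2 _ _).
Qed.

Lemma norm1_le_norm2 u : norm1 u <= Num.sqrt p%:R * norm2 u.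
Proof.
have := sum_abs_le_norm2 [set: 'I_p] u; rewrite cardsT card_ord.
by congr (_ <= _); apply: eq_bigl => i; rewrite inE.
Qed.

(* Cauchy-Schwarz against the basis vectors: [(A v)_i ^ 2 <= A_ii v^T A v]. *)
Lemma psd_mulmx_le A v : is_psd A ->
  dotv (A *m v) (A *m v) <= \tr A * quadf A v.
Proof.
move=> psdA; rewrite dotvE /mxtrace mulr_suml; apply: ler_sum => i _.
have ei w : dotv (delta_mx i 0) w = w i 0.
  rewrite dotvE (bigD1 i)//= big1 ?addr0; first by rewrite mxE !eqxx mul1r.
  by move=> j ji; rewrite mxE (negbTE ji) mul0r.
have := psd_cauchy_schwarz (delta_mx i 0) v psdA.
by rewrite /quadf !ei -colE [col _ _ _ _]mxE expr2.
Qed.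

Lemma psd_trace_ge0 A : is_psd A -> 0 <= \tr A.
Proof.
move=> [_ psdA]; apply: sumr_ge0 => i _; have := psdA (delta_mx i 0).
rewrite /quadf -colE dotvE (bigD1 i)//= big1 ?addr0 => [|j ji].
  by rewrite !mxE !eqxx mul1r.
by rewrite mxE (negbTE ji) mul0r.
Qed.

(** With q = [quadf A v], Cauchy-Schwarz and [psd_mulmx_le] give q^2 <= |v|^2 |A v|^2 <= |v|^2 tr(A)
    q, and a positive q cancels. *)
Lemma psd_quadf_le_trace A v : is_psd A -> quadf A v <= \tr A * dotv v v.
Proof.
move=> psdA; have := psdA.2 v; rewrite le_eqVlt => /predU1P[<-|q0].
  by rewrite mulr_ge0 ?psd_trace_ge0 ?dotvv_ge0.
rewrite -(ler_pM2r q0) -expr2 mulrAC.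
have := psd_cauchy_schwarz v (A *m v) (is_psd_scalar ler01).
rewrite !quadf_scalar mul1mx !mul1r -/(quadf A v) => /le_trans; apply.
by rewrite mulrC ler_wpM2r ?dotvv_ge0 ?psd_mulmx_le.
Qed.

Lemma posdef_psd A : is_posdef A -> is_psd A.
Proof.
move=> [sA pA]; split=> // u.
by have [->|/pA/ltW//] := eqVneq u 0; rewrite quadf0.
Qed.

(** A nonzero row of the left kernel would be a zero of the quadratic form. *)
Lemma posdef_unitmx A : is_posdef A -> A \in unitmx.
Proof.
move=> [sA pA]; rewrite -row_free_unit -kermx_eq0; apply/eqP/row_matrixP => i.
rewrite row0; apply/eqP/negPn/negP => r0.
have /pA : (row i (kermx A))^T != 0 by rewrite trmx_eq0.
by rewrite /quadf dotv_mulmx -trmx_mul -row_mul mulmx_ker row0 trmx0 dotv0l ltxx.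
Qed.

Lemma trace_le_max_diag A : \tr A <= p%:R * max_diag A.
Proof.
rewrite mulr_natl -[p in _ *+ p]card_ord -sumr_const; apply: ler_sum => i _.
exact: (le_bigmax _ (fun i => A i i)).
Qed.

(** Rayleigh bound without diagonalization: let [c] be the largest shift keeping [A - c%:M] positive
    semidefinite. The bound holds with [c] by construction; maximality makes [A - c%:M] singular, so
    [c] is an eigenvalue and [lambda_min A <= c]. *)
Lemma lambda_min_le A u : is_posdef A -> lambda_min A * dotv u u <= quadf A u.
Proof.
move=> pA; have psdA := posdef_psd pA; have [sA pA'] := pA.
have [->|u0] := eqVneq u 0; first by rewrite dotv0l mulr0 quadf0.
have uu0 : 0 < dotv u u by rewrite lt_def dotvv_eq0 u0 dotvv_ge0.
pose E := [set c : R | is_psd (A - c%:M)].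
have E0 : E 0 by rewrite /E/= raddf0 subr0.
have EP c v : E c -> c * dotv v v <= quadf A v.
  by move=> [_ /(_ v)]; rewrite quadfB quadf_scalar subr_ge0.
have hsE : has_sup E.
  split; first by exists 0.
  exists (quadf A u / dotv u u) => c /EP => /(_ u).
  by rewrite ler_pdivlMr.
set c := sup E.
(* The supremum is attained: every Rayleigh quotient bounds [E] from above, hence bounds [c] too. *)
have Ec : E c.
  split; first by rewrite linearB/= tr_scalar_mx sA.
  move=> v; rewrite quadfB quadf_scalar subr_ge0.
  have [->|v0] := eqVneq v 0; first by rewrite dotv0l mulr0 quadf0.
  have vv0 : 0 < dotv v v by rewrite lt_def dotvv_eq0 v0 dotvv_ge0.
  rewrite -ler_pdivlMr//; apply: ge_sup; first by exists 0.
  by move=> e /EP => /(_ v); rewrite -ler_pdivlMr.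
apply: le_trans (EP c u Ec); rewrite ler_pM2r//.
set B := A - c%:M in Ec.
(* In the singular case [c] is an eigenvalue; comparing it with the infimum also takes a lower bound
   on the eigenvalues, here 0 by semidefiniteness. *)
have [uB|nuB] := boolP (B \in unitmx); last first.
  apply: ge_inf.
    exists 0 => a /eigenvalueP[v vA v0].
    have vT0 : v^T != 0 by rewrite trmx_eq0.
    have := psdA.2 v^T.
    rewrite /quadf dotv_mulmx -trmx_mul vA linearZ/= dotvZl pmulr_lge0//.
    by rewrite lt_def dotvv_eq0 vT0 dotvv_ge0.
  rewrite /= /eigenvalue; apply: contra nuB => k0.
  by rewrite -row_free_unit -kermx_eq0.
(* otherwise [B] is uniformly positive definite and [c] is not an upper bound *)
exfalso.
set D := invmx B; pose M := \tr (D^T *m D) * \tr B.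
have DD : is_psd (D^T *m D).
  split=> [|v]; first by rewrite trmx_mul trmxK.
  by rewrite /quadf -mulmxA dotv_mulmx trmxK dotvv_ge0.
(* Write v as [D *m (B *m v)] and apply the trace bounds first to [D^T *m D], then to [B]. *)
have Bv v : dotv v v <= M * quadf B v.
  rewrite -[X in dotv X X](mulKmx uB) -/D.
  have -> : dotv (D *m (B *m v)) (D *m (B *m v)) = quadf (D^T *m D) (B *m v).
    by rewrite /quadf -mulmxA [RHS]dotv_mulmx trmxK.
  apply: le_trans (psd_quadf_le_trace _ DD) _.
  by rewrite -mulrA ler_wpM2l ?psd_trace_ge0// psd_mulmx_le.
have M0 : 0 <= M by rewrite mulr_ge0// psd_trace_ge0.
(* The form of [B] dominates |v|^2 / (M + 1), so the shift can grow by that amount; the added 1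
   keeps the divisor positive. *)
have : E (c + (M + 1)^-1).
  split; first by rewrite linearB/= tr_scalar_mx sA.
  move=> v; rewrite quadfB quadf_scalar.
  have q0 : 0 <= quadf A v - c * dotv v v by rewrite subr_ge0 EP.
  have : dotv v v <= (M + 1) * (quadf A v - c * dotv v v).
    by have := Bv v; rewrite quadfB quadf_scalar; lra.
  by rewrite -ler_pdivrMl ?ltr_wpDl// mulrDl; lra.
move=> /(ub_le_sup hsE.2); rewrite -/c gerDl leNgt invr_gt0 => /negP; apply.
by rewrite ltr_wpDl.
Qed.
End LinAlg.

(** * Deterministic error bounds for the penalized minimizer *)

Section Deterministic.
Variables (R : realType) (p : nat).
Implicit Types (u v b xih : 'cV[R]_p) (U Uh : 'M[R]_p).

Definition suppv v : {set 'I_p} := [set i | v i 0 != 0].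

Lemma card_suppv v : #|suppv v| = norm0 v.
Proof. by apply: eq_card => i; rewrite !inE. Qed.

Lemma norm1_split (S : {set 'I_p}) v :
  norm1 v = \sum_(i in S) `|v i 0| + \sum_(i | i \notin S) `|v i 0|.
Proof. by rewrite /norm1 (bigID (mem S)). Qed.

(** Off the support of [v] the entries of [v + u] are those of [u]; on it the triangle inequality
    applies. *)
Lemma norm1D_supp_ge v u :
  \sum_(i | i \notin suppv v) `|u i 0| - \sum_(i in suppv v) `|u i 0|
    <= norm1 (v + u) - norm1 v.
Proof.
rewrite (norm1_split (suppv v) (v + u)) (norm1_split (suppv v) v).
have -> : \sum_(i | i \notin suppv v) `|v i 0| = 0.
  by apply: big1 => i; rewrite inE negbK => /eqP->; rewrite normr0.
have -> : \sum_(i | i \notin suppv v) `|(v + u) i 0| =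
          \sum_(i | i \notin suppv v) `|u i 0|.
  by apply: eq_bigr => i; rewrite inE negbK mxE => /eqP->; rewrite add0r.
have : \sum_(i in suppv v) `|v i 0| <=
    \sum_(i in suppv v) `|(v + u) i 0| + \sum_(i in suppv v) `|u i 0|.
  rewrite -big_split/=; apply: ler_sum => i _.
  by rewrite -{1}(addrK (u i 0) (v i 0)) [(v + u) i 0]mxE ler_normB.
lra.
Qed.

(** Exact second-order expansion at [v]; the smooth part has gradient [Uh *m v - xih]. *)
Lemma objectiveD Uh xih lambda v u : is_psd Uh ->
  objective Uh xih lambda (v + u) = objective Uh xih lambda v +
    (2^-1 * quadf Uh u + dotv (Uh *m v - xih) u +
      lambda * (norm1 (v + u) - norm1 v)).
Proof.
move=> [sU _]; rewrite /objective /quadf mulmxDr !dotv_lin.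
rewrite (dotv_sym u v sU) (dotvC (Uh *m v) u) (dotv_sym u v sU) (dotvC xih u).
by field.
Qed.

(** Optimality of [b] against [v] makes the increment in [objectiveD] nonpositive. The gradient term
    costs at most half of [lambda * norm1 (b - v)], which leaves a margin off the support. *)
Lemma lasso_basic Uh xih lambda (D : set 'cV[R]_p) v b :
    is_psd Uh -> 0 < lambda -> D v ->
    argmin D (objective Uh xih lambda) b ->
    norminf (Uh *m v - xih) <= lambda / 2 ->
  quadf Uh (b - v) + lambda * \sum_(i | i \notin suppv v) `|(b - v) i 0| <=
    3 * lambda * \sum_(i in suppv v) `|(b - v) i 0|.
Proof.
move=> psdU l0 Dv [_ /(_ _ Dv)] + hA; set u := b - v.
have -> : b = v + u by rewrite addrC subrK.
rewrite objectiveD// gerDl => hobj.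
have h1 := ler_wpM2l (ltW l0) (norm1D_supp_ge v u).
have h2 : - (lambda / 2 * norm1 u) <= dotv (Uh *m v - xih) u.
  rewrite lerNl (le_trans (ler_norm _))// normrN.
  by rewrite (le_trans (dotv_le_norminf _ _))// ler_wpM2r// norm1_ge0.
rewrite (norm1_split (suppv v) u) in h2.
move: hobj h1 h2.
set x := \sum_(_ in _) _; set y := \sum_(_ | _) _; set z := quadf _ _.
by rewrite mulrBr; lra.
Qed.

(** After rescaling [u] to norm 1, the root of the [U]-form is at least sqrt(cL), so that of the
    [Uh]-form is at least sqrt(cL)/2. Squaring gives the factor 1/4. *)
Lemma event_B_quadf Uh U s (cL : R) u : 0 < cL -> is_posdef U ->
    cL <= lambda_min U -> cone s u ->
    (forall u', cone s u' -> norm2 u' <= 1 ->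
      `|Num.sqrt (quadf U u') - Num.sqrt (quadf Uh u')| <= Num.sqrt cL / 2) ->
  is_psd Uh ->
  cL / 4 * norm2 u ^+ 2 <= quadf Uh u.
Proof.
move=> cL0 pU hcL [S [cS hS]] hB psdU.
have [->|u0] := eqVneq u 0.
  by rewrite sqr_norm2 dotv0l mulr0 quadf0.
have n0 : 0 < norm2 u by rewrite lt_def norm2_eq0 u0 norm2_ge0.
pose a := (norm2 u)^-1; have a0 : 0 < a by rewrite invr_gt0.
have := hB (a *: u).
rewrite norm2Z gtr0_norm// mulVf ?gt_eqF// => /(_ _ (lexx _)).
have hc : cone s (a *: u).
  exists S; split=> //.
  have H Q : \sum_(i | Q i) `|(a *: u) i 0| = a * \sum_(i | Q i) `|u i 0|.
    by rewrite mulr_sumr; apply: eq_bigr => i _; rewrite mxE normrM gtr0_norm.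
  by rewrite !H mulrCA ler_pM2l.
move=> /(_ hc); rewrite ler_norml => /andP[_ h].
have h1 : Num.sqrt cL <= Num.sqrt (quadf U (a *: u)).
  rewrite ler_wsqrtr// (le_trans _ (lambda_min_le _ pU))//.
  by rewrite -sqr_norm2 norm2Z gtr0_norm// mulVf ?gt_eqF// expr1n mulr1.
have h2 : Num.sqrt cL / 2 <= Num.sqrt (quadf Uh (a *: u)) by lra.
have : cL / 4 <= quadf Uh (a *: u).
  rewrite -(sqr_sqrtr (psdU.2 (a *: u))) -{1}(sqr_sqrtr (ltW cL0)).
  have s0 := sqrtr_ge0 cL.
  move: h2 s0; set x := Num.sqrt cL; set y := Num.sqrt _ => h2 s0.
  by have : (x / 2) ^+ 2 <= y ^+ 2; [rewrite ler_sqr ?nnegrE; lra|rewrite expr_div_n; lra].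
rewrite quadfZ /a exprVn => h3.
by rewrite -ler_pdivlMr ?exprn_gt0// [leRHS]mulrC.
Qed.

Lemma sqrtM_self (x : R) : 0 <= x -> Num.sqrt x * Num.sqrt x = x.
Proof. by move=> x0; rewrite -expr2 sqr_sqrtr. Qed.

(** With n the Euclidean error and r = sqrt(s), the chain cL/4 n^2 <= q <= 3 lambda r n yields n <=
    12 lambda r / cL. The constants are 144 = 12^2, 36 = 3 * 12 from the bound on q, and 48 = 4 * 12
    because the cone condition bounds the l1 norm by 4 r n. *)
Lemma lasso_error Uh U xih lambda s (cL : R) (D : set 'cV[R]_p) v b :
    0 < cL -> is_posdef U -> cL <= lambda_min U ->
    is_psd Uh -> 0 < lambda -> D v -> (norm0 v <= s)%N ->
    argmin D (objective Uh xih lambda) b ->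
    norminf (Uh *m v - xih) <= lambda / 2 ->
    (forall u', cone s u' -> norm2 u' <= 1 ->
      `|Num.sqrt (quadf U u') - Num.sqrt (quadf Uh u')| <= Num.sqrt cL / 2) ->
  [/\ norm2 (b - v) ^+ 2 <= 144 / cL ^+ 2 * (lambda ^+ 2 * s%:R),
      quadf Uh (b - v) <= 36 / cL * (lambda ^+ 2 * s%:R) &
      norm1 (b - v) <= 48 / cL * (lambda * s%:R) ].
Proof.
move=> cL0 pU hcL psdU l0 Dv vs hb hA hB.
have := lasso_basic psdU l0 Dv hb hA; set u := b - v => h.
have q0 := psdU.2 u.
have cu : cone s u.
  exists (suppv v); rewrite card_suppv; split => //.
  by rewrite -(ler_pM2l l0); move: h; lra.
have := event_B_quadf cL0 pU hcL cu hB psdU.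
have := sum_abs_le_norm2 (suppv v) u; rewrite card_suppv.
rewrite (norm1_split (suppv v)).
have x0 : 0 <= \sum_(i in suppv v) `|u i 0| by exact: sumr_ge0.
have y0 : 0 <= \sum_(i | i \notin suppv v) `|u i 0| by exact: sumr_ge0.
have hyx : \sum_(i | i \notin suppv v) `|u i 0| <=
   3 * \sum_(i in suppv v) `|u i 0|.
  by rewrite -(ler_pM2l l0); move: h; lra.
have n0 := norm2_ge0 u.
have hs : Num.sqrt (norm0 v)%:R <= Num.sqrt s%:R :> R.
  by rewrite ler_wsqrtr// ler_nat.
have {}hs := ler_wpM2r n0 hs.
have s0 := sqrtr_ge0 (s%:R : R).
have -> : s%:R = Num.sqrt s%:R ^+ 2 :> R by rewrite sqr_sqrtr.
move: hs x0 y0 hyx n0 s0 h q0.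
set x := \sum_(_ in _) _; set y := \sum_(_ | _) _; set q := quadf _ _.
set n := norm2 u; set r := Num.sqrt s%:R; set r' := Num.sqrt _.
move=> hs x0 y0 hyx n0 r0 h q0 hx hq.
have {hx}hx : x <= r * n by exact: le_trans hs.
have {h y0}h : q <= 3 * lambda * (r * n).
  have : 0 <= lambda * y by rewrite mulr_ge0// ltW.
  have : lambda * x <= lambda * (r * n) by rewrite ler_wpM2l// ltW.
  by lra.
(* One factor n is cancelled, so n = 0 is set aside. *)
have hn : n <= 12 / cL * (lambda * r).
  have [->|nn0] := eqVneq n 0; first by rewrite !mulr_ge0 ?invr_ge0// ltW.
  have np : 0 < n by rewrite lt_def nn0.
  rewrite -(ler_pM2r np) -(ler_pM2r cL0).
  have -> : 12 / cL * (lambda * r) * n * cL = 12 * (lambda * r) * n.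
    by field; rewrite gt_eqF.
  by move: (le_trans hq h); rewrite expr2; lra.
have lr0 : 0 <= lambda * r by rewrite mulr_ge0// ltW.
have ci0 : 0 < cL^-1 by rewrite invr_gt0.
split.
- have -> : 144 / cL ^+ 2 * (lambda ^+ 2 * r ^+ 2) = (12 / cL * (lambda * r)) ^+ 2.
    by field; rewrite gt_eqF.
  by rewrite ler_sqr ?nnegrE// mulr_ge0// mulr_ge0// ltW.
- have := ler_wpM2l lr0 hn.
  have -> : 36 / cL * (lambda ^+ 2 * r ^+ 2) =
            3 * (lambda * r * (12 / cL * (lambda * r))) by field; rewrite gt_eqF.
  lra.
- have := ler_wpM2l r0 hn.
  have -> : 48 / cL * (lambda * r ^+ 2) =
            4 * (r * (12 / cL * (lambda * r))) by field; rewrite gt_eqF.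
  lra.
Qed.

(** The functional estimator with the data frozen, as a function of the candidate vector. *)
Definition qfun Uh xih v : R := 2 * dotv xih v - quadf Uh v.

(** Expand [qfun] exactly around [v]: the part linear in [b - v] is twice the gradient term, bounded
    by duality of the max norm and the l1 norm. *)
Lemma qfun_error Uh U xi xih lambda v b : is_psd Uh -> U *m v = xi ->
    norminf (Uh *m v - xih) <= lambda / 2 ->
  `|qfun Uh xih b - dotv xi v| <= 2 * `|dotv v (xih - xi)| +
    `|quadf (Uh - U) v| + lambda * norm1 (b - v) + quadf Uh (b - v).
Proof.
move=> psdU hU hA; set u := b - v.
have -> : qfun Uh xih b - dotv xi v = 2 * dotv v (xih - xi) -
    quadf (Uh - U) v - 2 * dotv (Uh *m v - xih) u - quadf Uh u.
  have -> : b = v + u by rewrite addrC subrK.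
  clearbody u; have [sU _] := psdU.
  rewrite quadfB /qfun /quadf hU !mulmxDr !dotv_lin.
  rewrite (dotv_sym u v sU) (dotvC (Uh *m v) u) (dotv_sym u v sU).
  by rewrite (dotvC v xih) (dotvC v xi); ring.
have h2 := le_trans (dotv_le_norminf (Uh *m v - xih) u)
  (ler_wpM2r (norm1_ge0 u) hA).
have := psdU.2 u; move: h2.
move: (dotv v _) (quadf (_ - _) v) (dotv _ u) (quadf Uh u) (norm1 u).
move=> a c e q n he q0.
rewrite (le_trans (ler_normB _ _))// (ger0_norm q0) lerD2r.
rewrite (le_trans (ler_normB _ _))// normrM (ger0_norm (ler0n _ 2)).
have := ler_normB (2 * a) c; rewrite normrM (ger0_norm (ler0n _ 2)); lra.
Qed.

(** The objective vanishes at 0, so it is nonpositive at [b]; this gives the lower bound, and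
    semidefiniteness the upper one. *)
Lemma qfun_argmin_bounds Uh xih lambda (D : set 'cV[R]_p) b :
    is_psd Uh -> 0 < lambda -> D 0 -> argmin D (objective Uh xih lambda) b ->
  0 <= qfun Uh xih b <= 2 * dotv xih b.
Proof.
move=> psdU l0 D0 [_ /(_ _ D0)]; have := psdU.2 b.
have -> : objective Uh xih lambda 0 = 0.
  rewrite /objective quadf0 dotv0l /norm1 big1 => [|i _]; first by ring.
  by rewrite mxE normr0.
rewrite /objective /qfun (dotvC b); have := mulr_ge0 (ltW l0) (norm1_ge0 b).
lra.
Qed.

(** Both quantities are nonnegative, so their difference is controlled by [tau] and by
    [2 * dotv xih b]. The latter splits into the contributions of [xi] and of [xih - xi], with [b]
    in the ball of radius [gamma]. *)
Lemma qfun_crude_error Uh U xi xih lambda gamma tau cU v b :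
    is_psd Uh -> is_posdef U -> U *m v = xi -> 0 < lambda -> 0 <= gamma ->
    0 <= tau -> dotv xi v <= tau -> max_diag U <= cU ->
    argmin (ball2 gamma) (objective Uh xih lambda) b ->
  `|qfun Uh xih b - dotv xi v| <= tau +
     2 * Num.sqrt p%:R * gamma * (Num.sqrt (cU * tau) + norminf (xih - xi)).
Proof.
move=> psdU pU hU l0 g0 tau0 hv hcU hb.
have b0 : @ball2 R p gamma 0.
  by rewrite /ball2/= (le_trans _ g0)// le_eqVlt norm2_eq0 eqxx.
have := qfun_argmin_bounds psdU l0 b0 hb.
have theta0 : 0 <= dotv xi v by rewrite -hU dotvC; exact: (posdef_psd pU).2.
have [hbg _] := hb; rewrite /ball2/= in hbg.
have h1 : dotv xi b <= Num.sqrt p%:R * gamma * Num.sqrt (cU * tau).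
  apply: le_trans (ler_norm _) _; apply: le_trans (dotv_le_norm2 _ _) _.
  (* From xi = U v: |xi|^2 <= tr(U) v^T U v <= p cU tau. *)
  have hxi : norm2 xi <= Num.sqrt p%:R * Num.sqrt (cU * tau).
    rewrite -sqrtrM// -[norm2 xi]ger0_norm ?norm2_ge0// -sqrtr_sqr.
    rewrite ler_wsqrtr// sqr_norm2 -hU.
    apply: le_trans (psd_mulmx_le _ (posdef_psd pU)) _.
    have -> : quadf U v = dotv xi v by rewrite /quadf hU dotvC.
    rewrite mulrA ler_pM ?psd_trace_ge0//; first exact: posdef_psd.
    by rewrite (le_trans (trace_le_max_diag _))// ler_wpM2l.
  by rewrite mulrAC ler_pM ?norm2_ge0.
have h2 : dotv (xih - xi) b <= Num.sqrt p%:R * gamma * norminf (xih - xi).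
  apply: le_trans (ler_norm _) _; apply: le_trans (dotv_le_norminf _ _) _.
  rewrite mulrC ler_wpM2r ?norminf_ge0// (le_trans (norm1_le_norm2 _))//.
  by rewrite ler_wpM2l.
have -> : dotv xih b = dotv (xih - xi) b + dotv xi b by rewrite !dotv_lin subrK.
have s0 : 0 <= Num.sqrt p%:R * gamma by rewrite mulr_ge0.
have := mulr_ge0 s0 (norminf_ge0 (xih - xi)).
have := mulr_ge0 s0 (sqrtr_ge0 (cU * tau)).
move=> ? ? /andP[? ?]; rewrite ler_norml; lra.
Qed.

End Deterministic.

(** * The seminorm of a positive semidefinite form and its Lipschitz constant *)

Section PsdSeminorm.
Variables (R : realType) (p : nat).
Implicit Types (u v : 'cV[R]_p) (A : 'M[R]_p).

Lemma sqrt_quadfD A u v : is_psd A ->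
  Num.sqrt (quadf A (u + v)) <= Num.sqrt (quadf A u) + Num.sqrt (quadf A v).
Proof.
move=> psdA; have [sA qA] := psdA.
rewrite -ler_sqr ?nnegrE ?addr_ge0 ?sqrtr_ge0//.
rewrite sqrrD !sqr_sqrtr// -sqrtrM//.
have h : dotv u (A *m v) <= Num.sqrt (quadf A u * quadf A v).
  rewrite (le_trans (ler_norm _))// -sqrtr_sqr ler_wsqrtr//.
  exact: psd_cauchy_schwarz.
have -> : quadf A (u + v) = quadf A u + dotv u (A *m v) *+ 2 + quadf A v.
  by rewrite /quadf mulmxDr !dotv_lin (dotv_sym v u sA) mulr2n; ring.
by rewrite lerD2r lerD2l lerMn2r h.
Qed.

(** Reverse triangle inequality for the seminorm. It lets the inequality defining [event_B] pass
    from a dense subset to every vector. *)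
Lemma sqrt_quadf_lipschitz A u v : is_psd A ->
  `|Num.sqrt (quadf A u) - Num.sqrt (quadf A v)| <=
    Num.sqrt (\tr A) * norm2 (u - v).
Proof.
move=> psdA.
have h x y : Num.sqrt (quadf A x) - Num.sqrt (quadf A y) <=
    Num.sqrt (\tr A) * norm2 (x - y).
  have -> : norm2 (x - y) = Num.sqrt (dotv (x - y) (x - y)).
    by rewrite -sqr_norm2 sqrtr_sqr ger0_norm ?norm2_ge0.
  rewrite -sqrtrM ?psd_trace_ge0// lerBlDl.
  rewrite -{1}(subrK y x) addrC (le_trans (sqrt_quadfD _ _ psdA))// lerD2l.
  by rewrite ler_wsqrtr// psd_quadf_le_trace.
by rewrite ler_norml lerNl opprB h -(norm2N (u - v)) opprB h.
Qed.

End PsdSeminorm.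

(** * Separability of subsets of R^p *)

Section CountableDense.
Variables (R : realType) (p : nat).

(** Enumerate the boxes with rational centre and half-side 1/(k+1), and pick a point of [D] in each
    box that meets [D]. *)
Lemma countable_dense (D : set 'cV[R]_p) : D !=set0 ->
  exists2 f : nat -> 'cV[R]_p, (forall n, D (f n)) &
    forall u e, D u -> 0 < e -> exists n, norm2 (u - f n) <= e.
Proof.
move=> [u0 Du0].
pose B (k : 'cV[rat]_p * nat) :=
  [set v | D v /\ forall i, `|v i 0 - ratr (k.1 i 0)| < k.2.+1%:R^-1].
(* The point [u0] is the default for boxes missing [D] and for integers that encode no box. *)
pose f n := if unpickle n is Some k then
  (if pselect (exists v, B k v) then xget u0 (B k) else u0) else u0.
exists f => [n|u e Du e0].
  rewrite /f; case: unpickle => // k; case: pselect => // Bk.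
  by have [] := xgetPex u0 Bk.
(* Two points of a box this small differ by at most e/(p+1) per entry, hence by at most e in norm,
   as p <= (p+1)^2; the shift p+1 also covers p = 0. *)
have c0 : 0 < e / (2 * (p%:R + 1)) by rewrite divr_gt0// mulr_gt0// ltr_wpDl.
have [k /[!add0r] hk] := ltr_add_invr c0.
have /choice[q hq] : forall i, exists q : rat,
    `|u i 0 - ratr q| < k.+1%:R^-1.
  move=> i; have [] := @rat_in_itvoo R (u i 0 - k.+1%:R^-1) (u i 0 + k.+1%:R^-1).
    by rewrite ltrBlDr -addrA ltrDl addr_gt0// invr_gt0.
  by move=> q; rewrite in_itv/= -ltr_distl distrC; exists q.
pose K : 'cV[rat]_p * nat := (\col_i q i, k).
exists (pickle K); rewrite /f pickleK.
have BK : exists v, B K v by exists u; split=> // i; rewrite mxE.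
case: pselect => // {}BK; have [_] := xgetPex u0 BK.
move: (xget _ _) => v hv.
have h i : `|(u - v) i 0| <= e / (p%:R + 1).
  have := hv i; have := hq i; rewrite !mxE => h1 h2.
  have -> : u i 0 - v i 0 = (u i 0 - ratr (q i)) - (v i 0 - ratr (q i)) by ring.
  rewrite (le_trans (ler_normB _ _))//.
  have -> : e / (p%:R + 1) = e / (2 * (p%:R + 1)) + e / (2 * (p%:R + 1)).
    by field; rewrite gt_eqF// ltr_wpDl.
  by rewrite lerD// ltW// (lt_trans _ hk).
rewrite -ler_sqr ?nnegrE ?norm2_ge0//; last exact: ltW.
rewrite sqr_norm2 dotvE.
apply: (@le_trans _ _ (\sum_(i < p) (e / (p%:R + 1)) ^+ 2)).
  apply: ler_sum => i _.
  by rewrite -expr2 -[leLHS]real_normK ?num_real// ler_sqr// nnegrE (le_trans _ (h i)).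
rewrite sumr_const card_ord -[leLHS]mulr_natl expr_div_n mulrCA -[leRHS]mulr1.
rewrite ler_wpM2l ?sqr_ge0// ler_pdivrMr ?exprn_gt0 ?ltr_wpDl// mul1r.
by have : 0 <= p%:R :> R; [exact: ler0n|nra].
Qed.

End CountableDense.

(** * Measurability of the estimators' functionals and of the two events *)

Section Measurability.
Variables (R : realType) (p : nat) (d : measure_display) (T : measurableType d).
Implicit Types (X Y : T -> 'cV[R]_p) (M : T -> 'M[R]_p).

Lemma measurable_vec_cst (v : 'cV[R]_p) : measurable_vec (fun _ : T => v).
Proof. by move=> i; exact: measurable_cst. Qed.

Lemma measurable_mat_cst (A : 'M[R]_p) : measurable_mat (fun _ : T => A).
Proof. by move=> i j; exact: measurable_cst. Qed.

Lemma measurable_vecB X Y : measurable_vec X -> measurable_vec Y ->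
  measurable_vec (fun w => X w - Y w).
Proof.
move=> mX mY i; under eq_fun do rewrite !mxE.
exact: measurable_funB.
Qed.

Lemma measurable_matB M N : measurable_mat M -> measurable_mat N ->
  measurable_mat (fun w => M w - N w).
Proof.
move=> mM mN i j; under eq_fun do rewrite !mxE.
exact: measurable_funB.
Qed.

Lemma measurable_vec_mulmx M X : measurable_mat M -> measurable_vec X ->
  measurable_vec (fun w => M w *m X w).
Proof.
move=> mM mX i; under eq_fun do rewrite mxE.
by apply: measurable_sum => j; exact: measurable_funM.
Qed.

Lemma measurable_dotv X Y : measurable_vec X -> measurable_vec Y ->
  measurable_fun [set: T] (fun w => dotv (X w) (Y w)).
Proof.
move=> mX mY; under eq_fun do rewrite dotvE.
by apply: measurable_sum => j; exact: measurable_funM.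
Qed.

Lemma measurable_quadf M X : measurable_mat M -> measurable_vec X ->
  measurable_fun [set: T] (fun w => quadf (M w) (X w)).
Proof. by move=> mM mX; exact/measurable_dotv/measurable_vec_mulmx. Qed.

Lemma measurable_norminf X : measurable_vec X ->
  measurable_fun [set: T] (fun w => norminf (X w)).
Proof.
move=> mX; under eq_fun do rewrite /norminf /Num.norm/= mx_normrE.
elim: (index_enum _) => [|ij s ih].
  by under eq_fun do rewrite big_nil; exact: measurable_cst.
under eq_fun do rewrite big_cons; apply: measurable_maxr => //.
rewrite (ord1 ij.2); exact: measurableT_comp (mX ij.1).
Qed.

Lemma measurable_le_cst (f : T -> R) (a : R) : measurable_fun [set: T] f ->
  measurable [set w | f w <= a].
Proof.
move=> mf; rewrite -[X in measurable X]setTI.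
by apply: measurable_fun_le => //; exact: measurable_cst.
Qed.

Lemma measurable_event_A (xihat : T -> 'cV[R]_p) (Uhat : T -> 'M[R]_p) lambda theta :
  measurable_vec xihat -> measurable_mat Uhat ->
  measurable (event_A xihat Uhat lambda theta).
Proof.
move=> mx mU; apply: measurable_le_cst; apply: measurable_norminf.
by apply: measurable_vecB => //; apply: measurable_vec_mulmx => //;
  exact: measurable_vec_cst.
Qed.

Lemma event_BP (Uhat : T -> 'M[R]_p) s kappa theta w :
  event_B Uhat s kappa theta w <->
  forall u, cone s u -> norm2 u <= 1 ->
    `|Num.sqrt (quadf theta.2 u) - Num.sqrt (quadf (Uhat w) u)| <= kappa.
Proof.
split=> [h u cu nu|h].
  rewrite -lee_fin; apply: le_trans h; apply: ereal_sup_ubound.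
  by exists u.
by apply: ge_ereal_sup => _ [u [cu nu] <-]; rewrite lee_fin h.
Qed.

(* The supremum over [cone s `&` ball2 1] may be restricted to a countable dense subset. *)
Lemma measurable_event_B (Uhat : T -> 'M[R]_p) s kappa theta :
  measurable_mat Uhat -> (forall w, is_psd (Uhat w)) -> is_psd theta.2 ->
  measurable (event_B Uhat s kappa theta).
Proof.
move=> mU psdU psdt.
have [|f fD fd] := @countable_dense R p (cone s `&` @ball2 R p 1).
  exists 0; split.
    exists finset.set0; rewrite cards0; split=> //.
    by rewrite big1 => [|i _]; [rewrite mulr_ge0// sumr_ge0|rewrite mxE normr0].
  by rewrite /ball2/= (le_trans _ ler01)// le_eqVlt norm2_eq0 eqxx.
pose g w u := `|Num.sqrt (quadf theta.2 u) - Num.sqrt (quadf (Uhat w) u)|.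
suff -> : event_B Uhat s kappa theta = \bigcap_n [set w | g w (f n) <= kappa].
  apply: bigcapT_measurable => n; apply: measurable_le_cst.
  apply: measurableT_comp => //; apply: measurable_funB.
    exact: measurable_cst.
  have msqrt : measurable_fun [set: R] (@Num.sqrt R).
    exact: (continuous_measurable_fun (@sqrt_continuous R)).
  apply: (measurableT_comp msqrt).
  by apply: measurable_quadf => //; exact: measurable_vec_cst.
apply/seteqP; split=> w.
  by move=> /event_BP h n _; have [] := fD n; exact: h.
move=> h; apply/event_BP => u cu nu; rewrite -/(g w u).
(* A dense point within e/L of [u] changes the gap by at most e; the 1 in [L] only ensures
   positivity. *)
apply/ler_addgt0Pr => e e0.
pose L := Num.sqrt (\tr theta.2) + Num.sqrt (\tr (Uhat w)) + 1.
have L0 : 0 < L by rewrite ltr_wpDl// addr_ge0// sqrtr_ge0.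
have [n hn] := fd u (e / L) (conj cu nu) (divr_gt0 e0 L0).
have h1 := sqrt_quadf_lipschitz u (f n) psdt.
have h2 := sqrt_quadf_lipschitz u (f n) (psdU w).
have h3 : L * norm2 (u - f n) <= e by rewrite mulrC -ler_pdivlMr.
have {}h := h n I; rewrite /= /g in h.
have := norm2_ge0 (u - f n).
move: h1 h2 h3 h; rewrite /g /L !ler_norml !mulrDl mul1r.
move: (Num.sqrt _ * _) (Num.sqrt _ * _) => x y.
by move=> /andP[? ?] /andP[? ?] ? /andP[? ?] ?; apply/andP; split; lra.
Qed.

End Measurability.

(** * Expectations of nonnegative variables, Cauchy-Schwarz and tail integration *)

Section Expectation.
Context d (T : measurableType d) (R : realType) (P : probability T R).
Implicit Types (X Y f g : T -> R).
Local Open Scope ereal_scope.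

(** Nonnegativity replaces integrability, so infinite expectations are allowed. *)
Lemma ge0_expectationD X Y : measurable_fun [set: T] X ->
    measurable_fun [set: T] Y -> (forall w, 0 <= X w)%R -> (forall w, 0 <= Y w)%R ->
  'E_P[fun w => (X w + Y w)%R] = 'E_P[X] + 'E_P[Y].
Proof.
move=> mX mY X0 Y0; rewrite unlock; under eq_integral do rewrite EFinD.
by rewrite ge0_integralD// => [w _||w _|];
  rewrite ?lee_fin//; exact/measurable_EFinP.
Qed.

Lemma ge0_expectationZl k X : (0 <= k)%R -> measurable_fun [set: T] X ->
    (forall w, 0 <= X w)%R ->
  'E_P[fun w => (k * X w)%R] = k%:E * 'E_P[X].
Proof.
move=> k0 mX X0; rewrite unlock; under eq_integral do rewrite EFinM.
by rewrite ge0_integralZl// => [|w _]; [exact/measurable_EFinP|rewrite lee_fin].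
Qed.

Lemma ge0_expectation_le X Y : measurable_fun [set: T] X ->
    measurable_fun [set: T] Y -> (forall w, 0 <= X w)%R ->
    (forall w, X w <= Y w)%R -> 'E_P[X] <= 'E_P[Y].
Proof.
move=> mX mY X0 XY; apply: expectation_le => //; last exact: aeW.
by move=> w; exact: le_trans (XY w).
Qed.

(** Hoelder's inequality with both exponents equal to 2, restated with square roots of extended
    reals. *)
Lemma expectation_cauchy_schwarz f g :
    measurable_fun [set: T] f -> measurable_fun [set: T] g ->
    (forall w, 0 <= f w)%R -> (forall w, 0 <= g w)%R ->
  'E_P[fun w => (f w * g w)%R] <=
    sqrte 'E_P[fun w => (f w ^+ 2)%R] * sqrte 'E_P[fun w => (g w ^+ 2)%R].
Proof.
move=> mf mg f0 g0; have h2 : (2^-1 + 2^-1 = 1 :> R)%R by lra.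
have := hoelder P mf mg (ltr0Sn _ 1) (ltr0Sn _ 1) h2.
have N2 (h : T -> R) : 'N[P]_2%:E[EFin \o h] = sqrte 'E_P[fun w => (h w ^+ 2)%R].
  rewrite -poweR12_sqrt; last by apply: expectation_ge0 => w; exact: sqr_ge0.
  rewrite !unlock /=; congr (_ `^ _); apply: eq_integral => w _.
  by rewrite powR_mulrn// real_normK ?num_real.
rewrite !N2 Lnorm1 unlock => h; apply: le_trans h.
rewrite le_eqVlt; apply/orP; left; apply/eqP/eq_integral => w _ /=.
by rewrite ger0_norm// mulr_ge0.
Qed.

Lemma expectation_norm_le_sqrt f : measurable_fun [set: T] f ->
  'E_P[fun w => `|f w|%R] <= sqrte 'E_P[fun w => (`|f w| ^+ 2)%R].
Proof.
move=> mf.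
have mnf : measurable_fun [set: T] (fun w => `|f w|%R) by exact: measurableT_comp.
have := expectation_cauchy_schwarz mnf (@measurable_cst _ _ T R setT 1%R)
  (fun=> normr_ge0 _) (fun=> ler01).
have -> : (fun w => `|f w| * cst 1 w)%R = (fun w => `|f w|)%R :> (T -> R).
  by apply/funext => w; rewrite mulr1.
have -> : (fun w => cst 1 w ^+ 2)%R = cst 1%R :> (T -> R).
  by apply/funext => w; rewrite expr1n.
by rewrite expectation_cst /= sqrtr1 mule1.
Qed.

Lemma expectation_mul_indic_le Y (A : set T) : measurable_fun [set: T] Y ->
    measurable A -> (forall w, 0 <= Y w)%R ->
  'E_P[fun w => (Y w * \1_A w)%R] <=
    sqrte 'E_P[fun w => (Y w ^+ 2)%R] * sqrte (P A).
Proof.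
move=> mY mA Y0.
have := expectation_cauchy_schwarz mY (measurable_indic mA) Y0
  (fun w => ler0n _ (w \in A)).
have -> : (fun w => \1_A w ^+ 2)%R = \1_A :> (T -> R).
  by apply/funext => w; rewrite indicE; case: (w \in A); rewrite ?expr1n ?expr0n.
by rewrite expectation_indic.
Qed.

(* Layer cake for [Y ^+ 2]: [\int_0^oo P(Y > sqrt r) dr <= \int_0^oo a e^(-c r) dr]. *)
Lemma expectation_sqr_tail_le Y (a c : R) : measurable_fun [set: T] Y ->
    (forall w, 0 <= Y w)%R -> (0 <= a)%R -> (0 < c)%R ->
    (forall t : R, (0 < t)%R ->
       P [set w | (t < Y w)%R] <= (a * expR (- (c * t ^+ 2)))%:E) ->
  'E_P[fun w => (Y w ^+ 2)%R] <= (a / c)%:E.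
Proof.
move=> mY Y0 a0 c0 tail.
have mY2 : measurable_fun [set: T] (fun w => (Y w ^+ 2)%R) by exact: measurable_funX.
pose Z : {RV P >-> R} := HB.pack (fun w => (Y w ^+ 2)%R)
  (isMeasurableFun.Build _ _ _ _ _ mY2).
have -> : 'E_P[fun w => (Y w ^+ 2)%R] = 'E_P[Z] by [].
(* The tail bound a e^(-c r) is a/c times the exponential density of rate c, whose total mass is
   1. *)
have mexp : measurable_fun [set: R] (fun x => (a / c * exponential_pdf c x)%:E).
  apply/measurable_EFinP/measurable_funM; first exact: measurable_cst.
  exact: measurable_exponential_pdf.
rewrite ge0_expectation_ccdf => [|w]; last exact: sqr_ge0.
(* The endpoint 0 is dropped because the tail bound is assumed for t > 0. *)
rewrite -integral_itv_obnd_cbnd; last exact: (measurable_funTS (ccdf_measurable Z)).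
apply: (@le_trans _ _ (\int[lebesgue_measure]_x (a / c * exponential_pdf c x)%:E)).
  apply: (@le_trans _ _ (\int[lebesgue_measure]_(x in `]0%R, +oo[)
      (a / c * exponential_pdf c x)%:E)).
    apply: ge0_le_integral => //=.
    - exact: (measurable_funTS (ccdf_measurable Z)).
    - exact: measurable_funTS.
    move=> r; rewrite in_itv/= andbT => r0.
    rewrite (exponential_pdfE _ (ltW r0)) mulrA divfK ?gt_eqF//.
    have -> : ccdf Z r = P [set w | (Num.sqrt r < Y w)%R].
      rewrite /ccdf /distribution /pushforward; congr (P _).
      apply/seteqP; split=> w /=; rewrite in_itv/= andbT;
        by rewrite -[in (r < _)%R](sqr_sqrtr (ltW r0)) ltr_sqr ?nnegrE ?sqrtr_ge0.
    have := tail (Num.sqrt r); rewrite sqrtr_gt0 (sqr_sqrtr (ltW r0)) => /(_ r0).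
    by rewrite mulNr.
  apply: ge0_subset_integral => // x _.
  by rewrite lee_fin mulr_ge0 ?exponential_pdf_ge0 ?divr_ge0// ltW.
under eq_integral do rewrite EFinM.
rewrite ge0_integralZl//=.
- by rewrite integral_exponential_pdf// mule1.
- by apply/measurable_EFinP; exact: measurable_exponential_pdf.
- by move=> x _; rewrite lee_fin exponential_pdf_ge0// ltW.
- by rewrite lee_fin divr_ge0// ltW.
Qed.

End Expectation.

(** The norm bound is cL |varpi|^2 <= varpi^T Upsilon varpi = xi^T varpi <= tau; it makes
    [varpi_of theta] feasible for the constrained minimization. *)
Lemma param_space_props (R : realType) (p s : nat) (cL cU tau : R)
    (theta : 'cV[R]_p * 'M[R]_p) : 0 < cL -> @param_space R p cL cU s tau theta ->
  [/\ is_posdef theta.2, cL <= lambda_min theta.2, max_diag theta.2 <= cU &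
      theta.2 *m varpi_of theta = theta.1] /\
  [/\ (norm0 (varpi_of theta) <= s)%N, dotv theta.1 (varpi_of theta) <= tau &
      norm2 (varpi_of theta) <= (Num.sqrt cL)^-1 * Num.sqrt tau].
Proof.
move=> cL0 [/= pU vs hv /andP[hcL _] hcU]; rewrite -/(varpi_of theta) in vs hv.
have hU : theta.2 *m varpi_of theta = theta.1 by rewrite mulKVmx ?posdef_unitmx.
do 2!split=> //.
rewrite -sqrtrV -?sqrtrM ?invr_ge0 ?(ltW cL0)//.
rewrite -[leLHS]ger0_norm ?norm2_ge0// -sqrtr_sqr ler_wsqrtr// sqr_norm2.
rewrite ler_pdivlMl// (le_trans _ hv)// -hU dotvC.
by rewrite (le_trans _ (lambda_min_le _ pU))// ler_wpM2r// dotvv_ge0.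
Qed.

(** Serves to absorb a probability into its square root. *)
Lemma lee_sqrte (R : realType) (x : \bar R) :
  (0 <= x)%E -> (x <= 1)%E -> (x <= sqrte x)%E.
Proof.
case: x => // x; rewrite !lee_fin => x0 x1.
rewrite -[leLHS](sqr_sqrtr x0) expr2 ler_piMl ?sqrtr_ge0//.
by rewrite -[leRHS]sqrtr1 ler_wsqrtr.
Qed.

(** * Risk bounds at a fixed parameter *)

Section Risk.
Variables (R : realType) (cL cU c1 c2 k1 k2 : R) (p s : nat).
Variables (tau m lambda gamma : R).
Variables (d : measure_display) (T : measurableType d) (Pr : probability T R).
Variables (xihat : T -> 'cV[R]_p) (Uhat : T -> 'M[R]_p) (varpihat : T -> 'cV[R]_p).
Variable theta : 'cV[R]_p * 'M[R]_p.
Hypotheses (cL0 : 0 < cL) (c10 : 0 < c1) (c20 : 0 < c2) (cU0 : 0 < cU).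
Hypotheses (hk1 : (Num.sqrt cL)^-1 <= k1) (hk12 : k1 <= k2).
Hypotheses (p0 : (0 < p)%N) (tau0 : 0 < tau) (m1 : 1 <= m) (lambda0 : 0 < lambda).
Hypotheses (hg1 : k1 * Num.sqrt tau <= gamma) (hg2 : gamma <= k2 * Num.sqrt tau).
Hypotheses (mx : measurable_vec xihat) (mU : measurable_mat Uhat).
Hypotheses (mv : measurable_vec varpihat) (psdU : forall w, is_psd (Uhat w)).
Hypothesis hv : forall w, argmin (@ball2 R p gamma)
  (objective (Uhat w) (xihat w) lambda) (varpihat w).
Hypothesis Htheta : @param_space R p cL cU s tau theta.

Let U := theta.2.
Let xi := theta.1.
Let v := varpi_of theta.
Let A := event_A xihat Uhat lambda theta.
Let B := event_B Uhat s (Num.sqrt cL / 2) theta.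
Let off := ~` A `|` ~` B.

Let st0 : 0 <= Num.sqrt tau. Proof. exact: sqrtr_ge0. Qed.
Let k20 : 0 < k2.
Proof.
by rewrite (lt_le_trans _ hk12)// (lt_le_trans _ hk1)// invr_gt0 sqrtr_gt0.
Qed.
Let gamma0 : 0 <= gamma.
Proof.
by rewrite (le_trans _ hg1)// mulr_ge0// (le_trans _ hk1)// invr_ge0.
Qed.

Let pU : is_posdef U. Proof. by have [[]] := param_space_props cL0 Htheta. Qed.
Let hcL : cL <= lambda_min U.
Proof. by have [[]] := param_space_props cL0 Htheta. Qed.
Let hcU : max_diag U <= cU.
Proof. by have [[]] := param_space_props cL0 Htheta. Qed.
Let Uv : U *m v = xi. Proof. by have [[]] := param_space_props cL0 Htheta. Qed.
Let vs : (norm0 v <= s)%N.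
Proof. by have [_ []] := param_space_props cL0 Htheta. Qed.
Let xiv : dotv xi v <= tau.
Proof. by have [_ []] := param_space_props cL0 Htheta. Qed.
Let vgamma : norm2 v <= gamma.
Proof.
have [_ [_ _ /le_trans]] := param_space_props cL0 Htheta; apply.
by apply: le_trans hg1; rewrite ler_wpM2r.
Qed.

Let mA : measurable A. Proof. exact: measurable_event_A. Qed.
Let mB : measurable B.
Proof. by apply: measurable_event_B => //; exact: posdef_psd. Qed.
Let moff : measurable off.
Proof. by apply: measurableU; exact: measurableC. Qed.

Let Poff : (Pr off <= Pr (~` A) + Pr (~` B))%E.
Proof. by apply: measureU2; exact: measurableC. Qed.

Let on_event w : ~ off w ->
  [/\ norm2 (varpihat w - v) ^+ 2 <= 144 / cL ^+ 2 * (lambda ^+ 2 * s%:R),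
      quadf (Uhat w) (varpihat w - v) <= 36 / cL * (lambda ^+ 2 * s%:R) &
      norm1 (varpihat w - v) <= 48 / cL * (lambda * s%:R) ].
Proof.
move=> /not_orP[/contrapT hA /contrapT/event_BP hB].
by apply: (@lasso_error _ _ _ U (xihat w) _ _ _ (@ball2 R p gamma)).
Qed.

(** Both vectors lie in the ball of radius [gamma <= k2 * Num.sqrt tau]. *)
Let crude_norm w : norm2 (varpihat w - v) ^+ 2 <= 4 * k2 ^+ 2 * tau.
Proof.
have -> : 4 * k2 ^+ 2 * tau = (2 * (k2 * Num.sqrt tau)) ^+ 2.
  by rewrite !exprMn sqr_sqrtr ?(ltW tau0)//; ring.
rewrite ler_sqr ?nnegrE ?norm2_ge0 ?mulr_ge0// ?(ltW k20)//.
rewrite (le_trans (norm2B _ _))//.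
have [hb _] := hv w; rewrite /ball2/= in hb.
by rewrite mulr_natl mulr2n lerD// (le_trans _ hg2).
Qed.

Lemma expected_norm2_error :
  ('E_Pr[fun w => (norm2 (varpihat w - v) ^+ 2)%R] <=
    (144 / cL ^+ 2 * (lambda ^+ 2 * s%:R))%:E +
    (4 * k2 ^+ 2 * tau)%:E * (Pr (~` A) + Pr (~` B)))%E.
Proof.
set a := 144 / _ * _; set b := 4 * _ * _.
have a0 : 0 <= a by rewrite !mulr_ge0// ?invr_ge0 ?exprn_ge0 ?(ltW cL0)// ltW.
have b0 : 0 <= b by rewrite !mulr_ge0 ?exprn_ge0 ?(ltW tau0)// ltW.
have moff' : measurable_fun [set: T] (\1_off : T -> R) by exact: measurable_indic.
have o0 w : 0 <= \1_off w :> R by exact: ler0n.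
have mbo : measurable_fun [set: T] (fun w => b * \1_off w).
  by apply: measurable_funM => //; exact: measurable_cst.
(* The sharp bound [a] holds outside [off] and the crude bound [b] on it. *)
apply: (@le_trans _ _ ('E_Pr[fun w => (a + b * \1_off w)%R])%E).
  apply: ge0_expectation_le => [||w|w]; last 2 first.
  - exact: sqr_ge0.
  - rewrite indicE; have [woff|] := boolP (w \in off).
      by rewrite mulr1 (le_trans (crude_norm w))// lerDr.
    by rewrite notin_setE mulr0 addr0 => /on_event[].
  - under eq_fun do rewrite sqr_norm2.
    by apply: measurable_dotv; apply: measurable_vecB => //;
      exact: measurable_vec_cst.
  - by apply: measurable_funD; [exact: measurable_cst|].
rewrite (ge0_expectationD Pr (measurable_cst a) mbo)//; last first.
  by move=> w; exact: mulr_ge0.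
rewrite (ge0_expectationZl Pr b0 moff')// [X in (X + _)%E](expectation_cst Pr a) expectation_indic//.
by rewrite leeD2l// lee_wpmul2l// lee_fin.
Qed.

Hypothesis tail : forall t : R, 0 < t ->
    (Pr [set w | (t < norminf (xihat w - theta.1))%R] <=
      (c1 * p%:R * expR (- (c2 * m * t ^+ 2)))%:E)%E.

Let Y w := norminf (xihat w - xi).
Let mY : measurable_fun [set: T] Y.
Proof.
by apply: measurable_norminf; apply: measurable_vecB.
Qed.
Let Y0 w : 0 <= Y w. Proof. exact: norminf_ge0. Qed.

(** Cauchy-Schwarz, with the second moment of [Y] at most c1 p / (c2 m) by the tail condition;
    [1 <= m] then removes m. *)
Let EY_off : ('E_Pr[fun w => (Y w * \1_off w)%R] <=
  (Num.sqrt p%:R * Num.sqrt (c1 / c2))%:E * sqrte (Pr off))%E.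
Proof.
apply: le_trans (expectation_mul_indic_le Pr mY moff Y0) _.
rewrite lee_wpmul2r ?sqrte_ge0//.
have cm : 0 < c2 * m by rewrite mulr_gt0// (lt_le_trans _ m1).
have := expectation_sqr_tail_le mY Y0 (mulr_ge0 (ltW c10) (ler0n R p)) cm tail.
rewrite -(lee_sqrt _); last first.
  by rewrite lee_fin divr_ge0 ?(ltW cm)// mulr_ge0 ?(ltW c10).
move=> /le_trans; apply; rewrite /= lee_fin -sqrtrM// ler_wsqrtr//.
rewrite mulrA (mulrC p%:R) ler_wpM2l ?mulr_ge0 ?(ltW c10)//.
by rewrite lef_pV2 ?posrE// ler_peMr// ltW.
Qed.

(** Outside [off] the two lasso terms add up to 84 = 48 + 36; on [off] the crude bound applies with
    [gamma <= k2 * Num.sqrt tau]. *)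
Let pointwise w : `|vartheta_hat xihat Uhat varpihat w - vartheta_of theta| <=
  2 * `|dotv v (xihat w - xi)| + `|quadf (Uhat w - U) v| +
  84 / cL * (lambda ^+ 2 * s%:R) +
  ((1 + 2 * k2 * Num.sqrt cU) * (tau * p%:R) * \1_off w +
   2 * Num.sqrt p%:R * k2 * Num.sqrt tau * (Y w * \1_off w)).
Proof.
have -> : vartheta_hat xihat Uhat varpihat w - vartheta_of theta =
  qfun (Uhat w) (xihat w) (varpihat w) - dotv xi v by [].
rewrite indicE; have [woff|] := boolP (w \in off); last first.
  rewrite notin_setE => noff; rewrite !mulr0 !addr0.
  have [_ h2 h3] := on_event noff.
  have hA : norminf (Uhat w *m v - xihat w) <= lambda / 2.
    by move/not_orP: noff => [/contrapT].
  rewrite (le_trans (qfun_error _ (psdU w) Uv hA))//.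
  have := ler_wpM2l (ltW lambda0) h3.
  have -> : lambda * (48 / cL * (lambda * s%:R)) = 48 / cL * (lambda ^+ 2 * s%:R).
    by ring.
  lra.
rewrite !mulr1.
have h := qfun_crude_error (psdU w) pU Uv lambda0 gamma0 (ltW tau0) xiv hcU (hv w).
apply: (le_trans h); rewrite -/(Y w).
rewrite sqrtrM ?(ltW cU0)//.
have p1 : 1 <= Num.sqrt p%:R :> R by rewrite -[leLHS]sqrtr1 ler_wsqrtr// ler1n.
have pp : Num.sqrt p%:R * Num.sqrt p%:R = p%:R :> R by rewrite sqrtM_self.
have tt : Num.sqrt tau * Num.sqrt tau = tau by rewrite sqrtM_self// ltW.
have c0 := sqrtr_ge0 cU.
rewrite -[leLHS]add0r; apply: lerD; first by rewrite !addr_ge0// !mulr_ge0// ?sqr_ge0// ?invr_ge0 ltW.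
have t0 := st0; set r := Num.sqrt p%:R in p1 pp *; set t := Num.sqrt tau in t0 tt *.
set c := Num.sqrt cU in c0 *.
apply: (@le_trans _ _ (tau + 2 * r * (k2 * t) * (c * t + Y w))).
  rewrite lerD2l ler_wpM2r ?addr_ge0 ?mulr_ge0//.
  by rewrite ler_wpM2l// mulr_ge0// (le_trans _ p1).
rewrite mulrDr addrA; apply: lerD; last by rewrite le_eqVlt !mulrA eqxx.
have -> : 2 * r * (k2 * t) * (c * t) = 2 * k2 * c * tau * r by rewrite -tt; ring.
(* Both tau and tau sqrt(p) are enlarged to tau p, so that they share one factor. *)
have rp : r <= p%:R by rewrite -pp ler_peMl// (le_trans _ p1).
have pR : 1 <= p%:R :> R by rewrite ler1n.
rewrite [leRHS]mulrDl mul1r; apply: lerD; first by rewrite ler_peMr// ltW.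
rewrite [leRHS]mulrA; apply: ler_wpM2l => //.
by rewrite !mulr_ge0// ltW.
Qed.

(** Integrates [pointwise] term by term. The free bound [Q] is later a sum of suprema, which makes
    the estimate uniform in [theta]. *)
Lemma expected_vartheta_error (Q : \bar R) :
    (Pr (~` A) + Pr (~` B) <= Q)%E ->
  ('E_Pr[fun w => `|vartheta_hat xihat Uhat varpihat w - vartheta_of theta|%R] <=
    2%:E * sqrte 'E_Pr[fun w => (`|dotv v (xihat w - xi)| ^+ 2)%R] +
    'E_Pr[fun w => `|quadf (Uhat w - U) v|%R] +
    (84 / cL * (lambda ^+ 2 * s%:R))%:E +
    ((1 + 2 * k2 * Num.sqrt cU) * (tau * p%:R) +
      2 * k2 * Num.sqrt (c1 / c2) * (Num.sqrt tau * p%:R))%:E * sqrte Q)%E.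
Proof.
move=> hQ.
have m1' : measurable_fun [set: T] (fun w => dotv v (xihat w - xi)).
  apply: measurable_dotv; first exact: measurable_vec_cst.
  by apply: measurable_vecB => //; exact: measurable_vec_cst.
have m1n : measurable_fun [set: T] (fun w => `|dotv v (xihat w - xi)|).
  exact: measurableT_comp.
have m2n : measurable_fun [set: T] (fun w => `|quadf (Uhat w - U) v|).
  apply: measurableT_comp => //; apply: measurable_quadf.
    by apply: measurable_matB => //; exact: measurable_mat_cst.
  exact: measurable_vec_cst.
have moff' : measurable_fun [set: T] (\1_off : T -> R) by exact: measurable_indic.
have o0 w : 0 <= \1_off w :> R by exact: ler0n.
have mYo : measurable_fun [set: T] (fun w => Y w * \1_off w) by exact: measurable_funM.
have Yo0 w : 0 <= Y w * \1_off w by rewrite mulr_ge0.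
set K := 84 / cL * _; set a := (1 + _) * _; set b := _ * _ * (_ * p%:R).
pose b' := 2 * Num.sqrt p%:R * k2 * Num.sqrt tau.
have K0 : 0 <= K by rewrite !mulr_ge0// ?invr_ge0 ?exprn_ge0 ?(ltW cL0)// ltW.
have a0 : 0 <= a by rewrite !mulr_ge0 ?addr_ge0 ?mulr_ge0 ?sqrtr_ge0// ltW.
have b'0 : 0 <= b' by rewrite !mulr_ge0 ?sqrtr_ge0// ltW.
have b0 : 0 <= b by rewrite !mulr_ge0 ?sqrtr_ge0// ltW.
pose f1 w := 2 * `|dotv v (xihat w - xi)|.
pose f2 w := `|quadf (Uhat w - U) v|.
have mf1 : measurable_fun [set: T] f1.
  by apply: measurable_funM => //; exact: measurable_cst.
have f10 w : 0 <= f1 w by rewrite mulr_ge0.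
have mf12 : measurable_fun [set: T] (fun w => f1 w + f2 w) by exact: measurable_funD.
have f120 w : 0 <= f1 w + f2 w by rewrite addr_ge0 ?normr_ge0.
have mf123 : measurable_fun [set: T] (fun w => f1 w + f2 w + K).
  by apply: measurable_funD => //; exact: measurable_cst.
have mao : measurable_fun [set: T] (fun w => a * \1_off w).
  by apply: measurable_funM => //; exact: measurable_cst.
have mbo : measurable_fun [set: T] (fun w => b' * (Y w * \1_off w)).
  by apply: measurable_funM => //; exact: measurable_cst.
have mab : measurable_fun [set: T] (fun w => a * \1_off w + b' * (Y w * \1_off w)).
  exact: measurable_funD.
have ao0 w : 0 <= a * \1_off w by rewrite mulr_ge0.
have bo0 w : 0 <= b' * (Y w * \1_off w) by rewrite mulr_ge0.
apply: (@le_trans _ _ ('E_Pr[fun w => (f1 w + f2 w + K +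
    (a * \1_off w + b' * (Y w * \1_off w)))%R])%E).
  apply: ge0_expectation_le => [||w|w]; [|exact: measurable_funD|by []|exact: pointwise].
  apply: measurableT_comp => //; apply: measurable_funB; last exact: measurable_cst.
  apply: measurable_funB; last exact: measurable_quadf.
  by apply: measurable_funM; [exact: measurable_cst|exact: measurable_dotv].
rewrite ge0_expectationD//; last 2 first.
- by move=> w; rewrite addr_ge0.
- by move=> w; rewrite addr_ge0.
rewrite (ge0_expectationD Pr mf12 (measurable_cst K))//.
rewrite [X in (_ + X + _)%E](expectation_cst Pr K).
rewrite (ge0_expectationD Pr mf1 m2n)//.
rewrite (ge0_expectationD Pr mao mbo)//.
rewrite (ge0_expectationZl Pr (ler0n R 2) m1n)//.
rewrite (ge0_expectationZl Pr a0 moff')// expectation_indic//.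
rewrite (ge0_expectationZl Pr b'0 mYo)//.
have Qoff : (Pr off <= Q)%E by exact: le_trans hQ.
have Q0 : (0 <= Q)%E by exact: le_trans Qoff.
have sQ : (sqrte (Pr off) <= sqrte Q)%E by rewrite lee_sqrt.
rewrite !leeD//.
  by rewrite lee_wpmul2l// expectation_norm_le_sqrt.
(* The first summand carries the probability of [off] itself, which is at most its square root. *)
rewrite EFinD ge0_muleDl ?lee_fin// leeD//.
  rewrite lee_wpmul2l ?lee_fin//; apply: le_trans sQ.
  by rewrite lee_sqrte// probability_le1.
(* The factor p arises as sqrt(p) from [b'] times sqrt(p) from [EY_off]. *)
have -> : b = b' * (Num.sqrt p%:R * Num.sqrt (c1 / c2)).
  by rewrite /b /b' -{1}(sqrtM_self (ler0n R p)); ring.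
rewrite [X in (_ <= X * _)%E]EFinM -muleA lee_wpmul2l ?lee_fin//.
apply: le_trans EY_off _; rewrite lee_wpmul2l// lee_fin mulr_ge0//;
  exact: sqrtr_ge0.
Qed.

End Risk.

(** * Uniform risk bounds over the parameter space *)

Theorem proposition3 (R : realType) (cL cU c1 c2 k1 k2 : R)
  (hcL : 0 < cL) (hcLU : cL < cU) (hc1 : 0 < c1) (hc2 : 0 < c2)
  (* gamma is comparable to sqrt tau, with a lower constant k1 large enough
     for varpi to satisfy the constraint norm2 varpi <= gamma *)
  (hk1 : (Num.sqrt cL)^-1 <= k1) (hk12 : k1 <= k2) :
  exists C : R, 0 < C /\
  forall (p s : nat) (tau m lambda gamma : R)
    (d : measure_display) (T : measurableType d)
    (P : 'cV[R]_p * 'M[R]_p -> probability T R)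
    (xihat : T -> 'cV[R]_p) (Uhat : T -> 'M[R]_p) (varpihat : T -> 'cV[R]_p),
  (1 <= s)%N -> (s <= p)%N -> 0 < tau -> 1 <= m -> 0 < lambda ->
  k1 * Num.sqrt tau <= gamma -> gamma <= k2 * Num.sqrt tau ->
  measurable_vec xihat -> measurable_mat Uhat -> measurable_vec varpihat ->
  (forall w, is_psd (Uhat w)) ->
  (forall w, argmin (@ball2 R p gamma)
               (objective (Uhat w) (xihat w) lambda) (varpihat w)) ->
  let H := @param_space R p cL cU s tau in
  let sup_H (F : 'cV[R]_p * 'M[R]_p -> \bar R) :=
    ereal_sup [set F theta | theta in H] in
  let prA : \bar R := sup_H (fun theta => P theta (~` event_A xihat Uhat lambda theta)) in
  let prB : \bar R := sup_H (fun theta =>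
    P theta (~` event_B Uhat s (Num.sqrt cL / 2) theta)) in
  (forall theta, H theta -> forall t : R, 0 < t ->
    (P theta [set w | (t < norminf (xihat w - theta.1))%R] <=
      (c1 * p%:R * expR (- (c2 * m * t ^+ 2)))%:E)%E) ->
  (sup_H (fun theta =>
      'E_(P theta)[fun w => (norm2 (varpihat w - varpi_of theta) ^+ 2)%R])
    <= C%:E * ((lambda ^+ 2 * s%:R)%:E + tau%:E * (prA + prB)))%E
  /\
  (sup_H (fun theta =>
      'E_(P theta)[fun w =>
        `|vartheta_hat xihat Uhat varpihat w - vartheta_of theta|%R])
    <= C%:E * ((lambda * s%:R * (lambda + Num.sqrt (ln p%:R / m)))%:E
       + ((Num.sqrt tau + tau) * p%:R)%:E * sqrte (prA + prB)
       + sup_H (fun theta =>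
           'E_(P theta)[fun w =>
             `|quadf (Uhat w - theta.2) (varpi_of theta)|%R])
       + sup_H (fun theta =>
           sqrte ('E_(P theta)[fun w =>
             (`|dotv (varpi_of theta) (xihat w - theta.1)| ^+ 2)%R]))))%E.
Proof.
have cU0 : 0 < cU by exact: lt_trans hcLU.
have k20 : 0 < k2.
  by rewrite (lt_le_trans _ hk12)// (lt_le_trans _ hk1)// invr_gt0 sqrtr_gt0.
pose C1 := 144 / cL ^+ 2; pose C2 := 84 / cL; pose C3 := 4 * k2 ^+ 2.
pose C4 := 2 * k2 * Num.sqrt cU; pose C5 := 2 * k2 * Num.sqrt (c1 / c2).
have C10 : 0 <= C1 by rewrite divr_ge0 ?exprn_ge0// ltW.
have C20 : 0 <= C2 by rewrite divr_ge0// ltW.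
have C30 : 0 <= C3 by rewrite mulr_ge0 ?exprn_ge0// ltW.
have C40 : 0 <= C4 by rewrite !mulr_ge0 ?sqrtr_ge0// ltW.
have C50 : 0 <= C5 by rewrite !mulr_ge0 ?sqrtr_ge0// ltW.
(* One constant above every coefficient of both bounds; the 2 covers the factor of the linear term
   and the 1 in [1 + C4]. *)
pose C := C1 + C2 + C3 + C4 + C5 + 2.
have C0 : 0 < C by rewrite /C; lra.
exists C; split=> // p s tau m lambda gamma d T P xihat Uhat varpihat.
move=> s1 sp tau0 m1 lambda0 hg1 hg2 mx mU mv psdU hv H sup_H prA prB tail.
have p0 : (0 < p)%N by exact: leq_trans sp.
have sup_ub F theta : H theta -> (F theta <= sup_H F)%E.
  by move=> Ht; apply: ereal_sup_ubound; exists theta.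
have PAB theta : H theta -> (P theta (~` event_A xihat Uhat lambda theta) +
    P theta (~` event_B Uhat s (Num.sqrt cL / 2) theta) <= prA + prB)%E.
  move=> Ht; apply: leeD.
    exact: (sup_ub (fun theta => P theta (~` event_A xihat Uhat lambda theta))).
  exact: (sup_ub (fun theta => P theta (~` event_B Uhat s (Num.sqrt cL / 2) theta))).
(* A member of [H] is required: over an empty set the suprema are -oo. *)
have Q0 theta : H theta -> (0 <= prA + prB)%E.
  by move=> Ht; apply: le_trans (PAB _ Ht); rewrite adde_ge0.
have l2s : 0 <= lambda ^+ 2 * s%:R by rewrite mulr_ge0// exprn_ge0// ltW.
have CE (x y : \bar R) (c : R) : c <= C -> (0 <= x -> x <= y -> c%:E * x <= C%:E * y)%E.
  move=> cC x0 xy; apply: (@le_trans _ _ (C%:E * x)%E).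
    by rewrite lee_wpmul2r// lee_fin.
  by rewrite lee_wpmul2l// lee_fin ltW.
have C1C : C1 <= C by rewrite /C; lra.
have C2C : C2 <= C by rewrite /C; lra.
have C3C : C3 <= C by rewrite /C; lra.
have C4C : 1 + C4 <= C by rewrite /C; lra.
have C5C : C5 <= C by rewrite /C; lra.
have C1' : 1 <= C by rewrite /C; lra.
have C2' : 2 <= C by rewrite /C; lra.
split; apply: ge_ereal_sup => _ [theta Ht <-].
  apply: le_trans (expected_norm2_error (P theta) hcL hk1 hk12 tau0 lambda0
    hg1 hg2 mx mU mv psdU hv Ht) _.
  rewrite [leRHS]ge0_muleDr ?lee_fin//; last first.
    by rewrite mule_ge0 ?lee_fin ?(ltW tau0)// (Q0 _ Ht).
  rewrite EFinM (EFinM C3) -muleA; apply: leeD.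
    by apply: CE.
  apply: CE => //.
    by rewrite mule_ge0 ?lee_fin ?(ltW tau0)// adde_ge0.
  by rewrite lee_wpmul2l ?lee_fin ?(ltW tau0)// PAB.
apply: le_trans (expected_vartheta_error hcL hc1 hc2 cU0 hk1 hk12 p0 tau0 m1
  lambda0 hg1 hg2 mx mU mv psdU hv Ht (tail _ Ht) (PAB _ Ht)) _.
set E2 := sqrte _; set E1 := expectation _ _; set S1 := sup_H _; set S2 := sup_H _.
have E10 : (0 <= E1)%E by exact: expectation_ge0.
have E1S : (E1 <= S1)%E by exact: (sup_ub (fun theta => 'E_(P theta)[_])%E).
have E20 : (0 <= E2)%E by exact: sqrte_ge0.
have E2S : (E2 <= S2)%E by exact: (sup_ub (fun theta => sqrte 'E_(P theta)[_])%E).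
have st0 := sqrtr_ge0 tau; have sl0 := sqrtr_ge0 (ln p%:R / m).
have pR0 : 0 <= p%:R :> R by exact: ler0n.
have sR0 : 0 <= s%:R :> R by exact: ler0n.
have S10 : (0 <= S1)%E by exact: le_trans E1S.
have S20 : (0 <= S2)%E by exact: le_trans E2S.
have D0 : 0 <= lambda * s%:R * (lambda + Num.sqrt (ln p%:R / m)).
  by rewrite !mulr_ge0 ?addr_ge0// ltW.
have B0 : 0 <= (Num.sqrt tau + tau) * p%:R.
  by rewrite mulr_ge0 ?addr_ge0// ltW.
have G0 : (0 <= ((Num.sqrt tau + tau) * p%:R)%:E * sqrte (prA + prB))%E.
  by rewrite mule_ge0 ?sqrte_ge0 ?lee_fin.
rewrite !ge0_muleDr ?lee_fin ?adde_ge0 ?lee_fin//.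
(* Reorders the four terms to match the right-hand side one by one. *)
rewrite -addeA addeC (addeC (2%:E * _)%E) addeA; apply: leeD; last first.
  exact: CE.
apply: leeD; last by rewrite -[leLHS]mul1e; exact: CE.
apply: leeD.
  rewrite EFinM; apply: CE; rewrite ?lee_fin//.
  (* Adding the square root to the last factor [lambda] only enlarges the product. *)
  have -> : lambda ^+ 2 * s%:R = lambda * s%:R * lambda by ring.
  by rewrite ler_wpM2l ?mulr_ge0 ?lerDl// ltW.
rewrite muleA lee_wpmul2r ?sqrte_ge0// -EFinM lee_fin.
rewrite -/C4 -/C5 (mulrDl (Num.sqrt tau)) mulrDr addrC.
by apply: lerD; rewrite ler_wpM2r ?mulr_ge0 ?(ltW tau0)//.
Qed.
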